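(* Let $P$ be an $n\times n$ irreducible stochastic matrix with stationary distribution vector $\boldsymbol{\pi}$, partitioned as $$P=\begin{bmatrix}P_{11}&P_{12}\\P_{21}&P_{22}\end{bmatrix}$$ with $P_{11}$ of size $m\times m$ and $P_{22}$ of size $(n-m)\times(n-m)$, $1\le m\le n-1$. Let $P_1=P_{11}+P_{12}(I-P_{22})^{-1}P_{21}$ and $P_2=P_{22}+P_{21}(I-P_{11})^{-1}P_{12}$ be the stochastic complements. Partition $\boldsymbol{\pi}^T=[\boldsymbol{\pi}_1^T\ \boldsymbol{\pi}_2^T]$ conformally and let $\hat{\boldsymbol{\pi}}_i=\boldsymbol{\pi}_i/\|\boldsymbol{\pi}_i\|$, $i=1,2$. Then $$\kappa(P)=\kappa(P_1)+\kappa(P_2)+\gamma,$$ where $$\gamma=\begin{bmatrix}\hat{\boldsymbol{\pi}}_1^T&-\hat{\boldsymbol{\pi}}_2^T\end{bmatrix}(I-P+\mathbf{u}\mathbf{v}^T)^{-1}\begin{bmatrix}\|\boldsymbol{\pi}_2\|\mathbf{1}\\-\|\boldsymbol{\pi}_1\|\mathbf{1}\end{bmatrix}$$ and $\mathbf{u},\mathbf{v}\in\mathbb{C}^n$ are any vectors such that $\mathbf{v}^T\mathbf{1}\neq 0$ and $\boldsymbol{\pi}^T\mathbf{u}\neq 0$.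
   Context: A square nonnegative matrix $P$ is stochastic if $P\mathbf{1}=\mathbf{1}$, where $\mathbf{1}$ is the all-ones vector of appropriate size. The stationary distribution vector of an irreducible stochastic $P$ is the unique vector $\boldsymbol{\pi}$ with $\boldsymbol{\pi}^TP=\boldsymbol{\pi}^T$, $\boldsymbol{\pi}^T\mathbf{1}=1$ (it is entrywise positive). $\|\cdot\|$ denotes the vector 1-norm. Since $P$ is irreducible, $I-P_{11}$ and $I-P_{22}$ are nonsingular, $P_1,P_2$ are stochastic and irreducible, and $\hat{\boldsymbol{\pi}}_i$ is the stationary distribution vector of $P_i$. Kemeny's constant of an irreducible stochastic $N\times N$ matrix $Q$ with eigenvalues $\lambda_1=1,\lambda_2,\dots,\lambda_N$ (with algebraic multiplicity) is $\kappa(Q)=\sum_{i=2}^N\frac{1}{1-\lambda_i}$; equivalently $\kappa(Q)=\operatorname{Tr}\big((I-Q+\mathbf{1}\mathbf{h}^T)^{-1}\big)-1$ for any $\mathbf{h}$ with $\mathbf{h}^T\mathbf{1}=1$. *)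

(* Defs.v *)
From mathcomp Require Import all_boot all_order all_fingroup all_algebra.
From mathcomp Require Import reals complex.

Set Implicit Arguments.
Unset Strict Implicit.
Unset Printing Implicit Defensive.

Import Order.TTheory GRing.Theory Num.Theory.

Local Open Scope ring_scope.

Section MarkovChains.
Variable R : realType.

Definition stochastic (n : nat) (P : 'M[R]_n) : Prop :=
  (forall i j, 0 <= P i j) /\ P *m (const_mx 1 : 'cV[R]_n) = const_mx 1.

(* A simultaneous permutation of rows and columns makes A block upper
   triangular, with diagonal blocks of positive sizes k and n - k. *)
Definition reducible (n : nat) (A : 'M[R]_n) : Prop :=
  exists (s : 'S_n) (k : nat), (0 < k < n)%N /\
    forall i j : 'I_n, (k <= i)%N -> (j < k)%N -> A (s i) (s j) = 0.

Definition irreducible (n : nat) (A : 'M[R]_n) : Prop := ~ reducible A.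

Definition stationary (n : nat) (P : 'M[R]_n) (pi : 'cV[R]_n) : Prop :=
  pi^T *m P = pi^T /\ pi^T *m (const_mx 1 : 'cV[R]_n) = 1%:M.

Definition norm1 (n : nat) (x : 'cV[R]_n) : R := \sum_i `|x i 0|.

Definition normalize1 (n : nat) (x : 'cV[R]_n) : 'cV[R]_n :=
  (norm1 x)^-1 *: x.

Definition complexmx (m n : nat) (A : 'M[R]_(m, n)) : 'M[R[i]]_(m, n) :=
  map_mx (real_complex R) A.

(* The complex roots of the characteristic polynomial, listed with algebraic
   multiplicity. *)
Definition eigenvalues (n : nat) (A : 'M[R[i]]_n) : seq R[i] :=
  sval (closed_field_poly_normal (char_poly A)).

Lemma char_poly_eigenvalues (n : nat) (A : 'M[R[i]]_n) :
  char_poly A = \prod_(z <- eigenvalues A) ('X - z%:P).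
Proof.
rewrite /eigenvalues; case: closed_field_poly_normal => s /= {1}->.
by rewrite (monicP (char_poly_monic A)) scale1r.
Qed.

(* [rem] removes a single occurrence of the eigenvalue 1. *)
Definition kemeny (n : nat) (Q : 'M[R]_n) : R[i] :=
  \sum_(z <- rem 1 (eigenvalues (complexmx Q))) 1 / (1 - z).

Section StochasticComplements.
Variables m k : nat.
Implicit Types (P : 'M[R]_(m + k)) (pi : 'cV[R]_(m + k)).

Definition stoch_compl1 P : 'M[R]_m :=
  ulsubmx P + ursubmx P *m invmx (1%:M - drsubmx P) *m dlsubmx P.

Definition stoch_compl2 P : 'M[R]_k :=
  drsubmx P + dlsubmx P *m invmx (1%:M - ulsubmx P) *m ursubmx P.

Definition kemeny_gamma P pi (u v : 'cV[R[i]]_(m + k)) : R[i] :=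
  let pi1 := usubmx pi in
  let pi2 := dsubmx pi in
  (complexmx (row_mx (normalize1 pi1)^T (- (normalize1 pi2)^T))
   *m invmx (1%:M - complexmx P + u *m v^T)
   *m complexmx (col_mx (norm1 pi2 *: (const_mx 1 : 'cV_m))
                        (- (norm1 pi1 *: (const_mx 1 : 'cV_k))))) 0 0.

End StochasticComplements.
End MarkovChains.

(* Main.v *)
(* With A = I - P, the matrix G = (A + u v^T)^-1 satisfies A G A = A, and
   kappa(Q) = tr H - p^T H 1 for every H with (I - Q) H (I - Q) = I - Q, where p
   is the stationary vector of Q. Block elimination shows that the diagonal
   blocks of G are such generalized inverses of the Schur complements I - P_1
   and I - P_2 of A. Hence tr G splits, and kappa(P) - kappa(P_1) - kappa(P_2)
   is a combination of the numbers hat(pi)_i^T G_ij 1, which is gamma because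
   |pi_1| + |pi_2| = 1.
   The trace formula for kappa comes from char_poly (Q - 1 p^T) (X - 1) =
   X char_poly Q and Jacobi's formula at X = 1; the nonsingularity statements
   come from the maximum principle for irreducible stochastic matrices. *)

Require Import Defs.
From mathcomp Require Import all_boot all_order all_fingroup all_algebra.
From mathcomp Require Import reals complex ring.

Set Implicit Arguments.
Unset Strict Implicit.
Unset Printing Implicit Defensive.

Import Order.TTheory GRing.Theory Num.Theory.

Local Open Scope ring_scope.

(** * Derivatives of determinants and characteristic polynomials *)

Lemma deriv_prod (R : comNzRingType) (I : eqType) (r : seq I)
    (F : I -> {poly R}) :
  uniq r -> (\prod_(i <- r) F i)^`() =
  \sum_(i <- r) (F i)^`() * \prod_(j <- r | j != i) F j.
Proof.
elim: r => [|x r IH] /=; first by rewrite !big_nil derivC.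
move=> /andP[xr ur]; rewrite !big_cons derivM IH // mulr_sumr eqxx /=.
congr (_ * _ + _); rewrite big_seq_cond [RHS]big_seq_cond.
  by apply: eq_bigl => j; case: eqVneq => [->|]; rewrite ?(negPf xr) ?andbT.
apply: eq_bigr => i /andP[ir _]; rewrite mulrCA big_cons.
by have -> : x != i by apply: contraNneq xr => ->.
Qed.

(** Jacobi's formula, one row at a time: [N i] is [M] with row [i] differentiated, and its cofactors
    along that row are those of [M]. *)
Lemma deriv_det (R : comNzRingType) n (M : 'M[{poly R}]_n) :
  (\det M)^`() = \tr (map_mx (@deriv R) M *m \adj M).
Proof.
pose N i : 'M_n := \matrix_(k, j) if k == i then (M k j)^`() else M k j.
have cN i j : cofactor (N i) i j = cofactor M i j.
  congr (_ * \det _); apply/matrixP=> a b; rewrite !mxE.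
  by rewrite eq_sym (negPf (neq_lift _ _)).
transitivity (\sum_i \det (N i)); last first.
  apply: eq_bigr => i _; rewrite (expand_det_row _ i) mxE.
  by apply: eq_bigr => j _; rewrite cN !mxE eqxx.
rewrite /(\det M) raddf_sum /= exchange_big /=; apply: eq_bigr => s _.
rewrite -mulr_sumr.
have -> : (-1) ^+ s = ((-1) ^+ s)%:P :> {poly R} by rewrite rmorphXn rmorphN1.
rewrite derivM derivC mul0r add0r deriv_prod ?index_enum_uniq //.
congr (_ * _).
apply: eq_bigr => i _; rewrite [RHS](bigD1 i) //= mxE eqxx; congr (_ * _).
by apply: eq_bigr => j /negPf ji; rewrite mxE ji.
Qed.

Lemma map_horner_char_poly_mx (R : comNzRingType) n (A : 'M[R]_n) a :
  map_mx (horner_eval a) (char_poly_mx A) = a%:M - A.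
Proof.
apply/matrixP=> i j; rewrite !mxE /horner_eval hornerD hornerN hornerC.
by rewrite hornerMn hornerX.
Qed.

Lemma horner_char_poly (R : comNzRingType) n (A : 'M[R]_n) a :
  (char_poly A).[a] = \det (a%:M - A).
Proof. by rewrite -map_horner_char_poly_mx det_map_mx. Qed.

Lemma deriv_char_poly (R : comNzRingType) n (A : 'M[R]_n) a :
  (char_poly A)^`().[a] = \tr (\adj (a%:M - A)).
Proof.
rewrite -map_horner_char_poly_mx -map_mx_adj /char_poly deriv_det.
have -> : map_mx (@deriv R) (char_poly_mx A) = 1%:M.
  by apply/matrixP=> i j; rewrite !mxE derivB derivC subr0 derivMn derivX.
by rewrite mul1mx trace_map_mx.
Qed.

(** Logarithmic derivative; at [a = 1], over the eigenvalues left after removing one 1, the sum is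
    Kemeny's constant. *)
Lemma horner_deriv_prod_XsubC (F : fieldType) (s : seq F) (a : F) :
  let q := \prod_(z <- s) ('X - z%:P) in
  q.[a] != 0 -> q^`().[a] = q.[a] * \sum_(z <- s) 1 / (a - z).
Proof.
elim: s => [|z s IH] q; first by rewrite /q !big_nil derivC horner0 mulr0.
rewrite /q !big_cons derivM derivXsubC mul1r !hornerE mulf_eq0 negb_or.
move=> /andP[az /IH ->].
by field.
Qed.

(** * Deflation of an eigenvalue *)

(** Sylvester's identity: the two sides of [e] factor the same block matrix, with rows [[1, -U]] and
    [[V, 1]]. It reduces rank-one updates to 1 by 1 determinants. *)
Lemma det_1Dmulmx (R : comNzRingType) m n
    (U : 'M[R]_(m, n)) (V : 'M[R]_(n, m)) :
  \det (1%:M + U *m V) = \det (1%:M + V *m U).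
Proof.
have e : block_mx 1%:M 0 V 1%:M *m block_mx 1%:M (- U) 0 (1%:M + V *m U) =
         block_mx (1%:M + U *m V) (- U) 0 1%:M *m block_mx 1%:M 0 V 1%:M.
  rewrite !mulmx_block !(mul1mx, mulmx1, mul0mx, mulmx0, add0r, addr0).
  by rewrite mulmxN mulNmx addrK addrCA addNr addr0.
move/(congr1 (fun M => \det M)): e; rewrite !det_mulmx !det_ublock !det_lblock.
by rewrite !det1 !mul1r !mulr1 => ->.
Qed.

(* With J = w p^T, which is idempotent, and M = X I - A, for which
   J M = (X - 1) J, both sides are the determinant of M + (X - 1)^2 J. *)
Lemma char_poly_deflate (F : fieldType) n (A : 'M[F]_n) (w p : 'cV[F]_n) :
  p^T *m A = p^T -> p^T *m w = 1%:M ->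
  ('X - 1) * char_poly (A - w *m p^T) = 'X * char_poly A.
Proof.
move=> pA pw; pose f := map_mx (@polyC F).
pose M := char_poly_mx A; pose J := f _ _ w *m (f _ _ p)^T.
have JE : J = f _ _ (w *m p^T) by rewrite /J /f map_mxM map_trmx.
have pwf : (f _ _ p)^T *m f _ _ w = 1%:M.
  by rewrite map_trmx -map_mxM pw map_mx1.
have JJ : J *m J = J by rewrite /J mulmxA -(mulmxA (f _ _ w)) pwf mulmx1.
have JM : J *m M = ('X - 1) *: J.
  rewrite /M /char_poly_mx mulmxBr mul_mx_scalar scalerBl scale1r JE.
  by rewrite -map_mxM -mulmxA pA.
have detJ c : \det (1%:M + (c - 1) *: J) = c.
  rewrite /J scalemxAl det_1Dmulmx -scalemxAr pwf det_mx11 !mxE /=.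
  by rewrite mulr1n mulr1 addrC subrK.
have -> : char_poly (A - w *m p^T) = \det (M + J).
  congr (\det _); rewrite /char_poly_mx /M JE /char_poly_mx /f map_mxB.
  by rewrite opprB addrA addrAC.
transitivity (\det ((1%:M + ('X - 1 - 1) *: J) *m (M + J))).
  by rewrite det_mulmx detJ.
transitivity (\det ((1%:M + ('X - 1) *: J) *m M)); last first.
  by rewrite det_mulmx detJ.
congr (\det _); rewrite !mulmxDl !mul1mx -!scalemxAl mulmxDr JM JJ -addrA.
congr (_ + _).
rewrite -[X in _ *: (_ + X)]scale1r -scalerDl scalerA.
rewrite -[X in X + _]scale1r -scalerDl scalerA; congr (_ *: _).
by ring.
Qed.

(** * Generalized inverses of a singular matrix with known null vectors *)

Section GeneralizedInverse.
Variables (F : fieldType) (n : nat) (A : 'M[F]_n) (e p : 'cV[F]_n).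
Hypotheses (Ae : A *m e = 0) (pA : p^T *m A = 0) (pe : p^T *m e = 1%:M).
Hypothesis B_unit : A + e *m p^T \in unitmx.
Let Z := invmx (A + e *m p^T).

Let Ze : Z *m e = e.
Proof.
have Be : (A + e *m p^T) *m e = e.
  by rewrite mulmxDl Ae add0r -mulmxA pe mulmx1.
by rewrite -[in LHS]Be mulKmx.
Qed.

Let pZ : p^T *m Z = p^T.
Proof.
have pB : p^T *m (A + e *m p^T) = p^T.
  by rewrite mulmxDr pA add0r mulmxA pe mul1mx.
by rewrite -[in LHS]pB mulmxK.
Qed.

Let ZA : Z *m A = 1%:M - e *m p^T.
Proof.
rewrite -[X in Z *m X](addrK (e *m p^T)) mulmxBr mulVmx //.
by rewrite mulmxA Ze.
Qed.

Let AZ : A *m Z = 1%:M - e *m p^T.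
Proof.
rewrite -[X in X *m Z](addrK (e *m p^T)) mulmxBl mulmxV //.
by rewrite -mulmxA pZ.
Qed.

(** As [Z A = A Z = E], every generalized inverse [G] satisfies
    [E G E = Z A G A Z = Z A Z = Z - e p^T]; the formula is the trace of this. *)
Lemma mxtrace_fundamental (G : 'M[F]_n) :
  A *m G *m A = A -> \tr Z - 1 = \tr G - (p^T *m G *m e) 0 0.
Proof.
move=> AGA; pose E : 'M_n := 1%:M - e *m p^T.
have EE : E *m E = E.
  rewrite {1}/E mulmxBl mul1mx -[in X in _ - X]mulmxA mulmxBr mulmx1.
  by rewrite (mulmxA p^T) pe mul1mx subrr mulmx0 subr0.
have EGE : E *m G *m E = Z - e *m p^T.
  transitivity (Z *m (A *m G *m A) *m Z).
    by rewrite !mulmxA ZA -!mulmxA AZ.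
  rewrite AGA ZA.
  by rewrite mulmxBl mul1mx -mulmxA pZ.
move/(congr1 mxtrace): EGE.
rewrite mxtrace_mulC mulmxA EE mulmxBl mul1mx !raddfB /= => /esym.
rewrite (mxtrace_mulC e) pe mxtrace1 => ->; congr (_ - _).
by rewrite -trace_mx11 -[in LHS]mulmxA [LHS]mxtrace_mulC.
Qed.

(** [Z A = I - e p^T] shows that [e] spans the kernel of [A]. *)
Lemma ker_rank1_perturbation m (X : 'M[F]_(n, m)) :
  A *m X = 0 -> X = e *m (p^T *m X).
Proof.
move=> AX; have: Z *m A *m X = 0 by rewrite -mulmxA AX mulmx0.
by rewrite ZA mulmxBl mul1mx -mulmxA => /eqP; rewrite subr_eq0 => /eqP.
Qed.

Lemma coker_rank1_perturbation m (X : 'M[F]_(m, n)) :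
  X *m A = 0 -> X = X *m e *m p^T.
Proof.
move=> XA; have: X *m (A *m Z) = 0 by rewrite mulmxA XA mul0mx.
by rewrite AZ mulmxBr mulmx1 mulmxA => /eqP; rewrite subr_eq0 => /eqP.
Qed.

Variables u v : 'cV[F]_n.
Hypotheses (ve : (v^T *m e) 0 0 != 0) (pu : (p^T *m u) 0 0 != 0).

(** If [(A + u v^T) y = 0], multiplying by [p^T] gives [v^T y = 0]; then [A y = 0], so [y] is a
    multiple of [e], and [v^T e != 0] makes it zero. *)
Lemma unitmx_rank1_perturbation : A + u *m v^T \in unitmx.
Proof.
rewrite -unitmx_tr -row_free_unit; apply: inj_row_free => x /(congr1 trmx).
rewrite trmx_mul trmxK trmx0 => By; apply: (can_inj (@trmxK _ _ _)).
rewrite trmx0; move: {x}x^T By => y By.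
have vy : v^T *m y = 0.
  have /eqP := congr1 (mulmx p^T) By.
  rewrite mulmx0 mulmxDl mulmxDr !mulmxA pA mul0mx add0r -mulmxA.
  rewrite [p^T *m u]mx11_scalar mul_scalar_mx scaler_eq0 (negPf pu).
  by move/eqP.
move: By; rewrite mulmxDl -mulmxA vy mulmx0 addr0.
move/ker_rank1_perturbation => yE; move: vy; rewrite yE mulmxA.
rewrite [v^T *m e]mx11_scalar mul_scalar_mx => /eqP.
by rewrite scaler_eq0 (negPf ve) => /eqP ->; rewrite mulmx0.
Qed.

(** Since [p^T (A + u v^T)] is a nonzero multiple of [v^T], the row [v^T G] is a multiple of [p^T],
    so [v^T G A = 0]; the first [A] is then written as [(A + u v^T) - u v^T]. *)
Lemma ginv_rank1_perturbation : A *m invmx (A + u *m v^T) *m A = A.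
Proof.
have U := unitmx_rank1_perturbation; set G := invmx _.
have vGA : v^T *m G *m A = 0.
  have pB : p^T *m (A + u *m v^T) = (p^T *m u) 0 0 *: v^T.
    by rewrite mulmxDr pA add0r mulmxA {1}[p^T *m u]mx11_scalar mul_scalar_mx.
  have: (p^T *m u) 0 0 *: (v^T *m G *m A) = 0.
    by rewrite !scalemxAl -pB /G mulmxK.
  by move/eqP; rewrite scaler_eq0 (negPf pu) => /eqP.
rewrite -[X in X *m G](addrK (u *m v^T)) mulmxBl mulmxV // mulmxBl mul1mx.
by rewrite -2!mulmxA (mulmxA v^T) vGA mulmx0 subr0.
Qed.

End GeneralizedInverse.

(** * Kemeny's constant as a trace *)

(** After deflation, [char_poly (Q - e p^T) = X q] with [q] the product over the remaining
    eigenvalues. At 1 its value is [q(1) = det B] and its derivative [q(1) + q'(1) = tr (adj B)];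
    dividing gives [1 + kappa = tr B^-1]. *)
Lemma kemeny_fundamental (R : realType) n (Q : 'M[R]_n) (e p : 'cV[R[i]]_n) :
  p^T *m complexmx Q = p^T -> p^T *m e = 1%:M ->
  1%:M - complexmx Q + e *m p^T \in unitmx ->
  kemeny Q = \tr (invmx (1%:M - complexmx Q + e *m p^T)) - 1.
Proof.
move=> pQ pe; set B := _ + _ => uB.
have BE : B = 1%:M - (complexmx Q - e *m p^T) by rewrite opprB addrA addrAC.
have defl := char_poly_deflate pQ pe.
(* [rem] removes only what is present; the deflation identity at [X = 1] shows that 1 is a root. *)
have: 1 \in eigenvalues (complexmx Q).
  rewrite -root_prod_XsubC -char_poly_eigenvalues /root -[_.[1]]mul1r.
  by rewrite -{1}[1](hornerX 1) -hornerM -defl hornerM hornerXsubC subrr mul0r.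
move=> /perm_to_rem s1; rewrite /kemeny; set s := rem _ _ in s1 *.
pose q := \prod_(z <- s) ('X - z%:P).
have cE : char_poly (complexmx Q - e *m p^T) = 'X * q.
  have X1 : 'X - 1 != 0 :> {poly R[i]} by rewrite polyXsubC_eq0.
  apply: (mulfI X1).
  rewrite defl char_poly_eigenvalues (perm_big _ s1) big_cons.
  by rewrite mulrCA.
have q1 : q.[1] = \det B.
  by rewrite BE -horner_char_poly cE hornerM hornerX mul1r.
(* Thus 1 is a simple eigenvalue, and no denominator [1 - z] vanishes. *)
have q1_neq0 : q.[1] != 0 by rewrite q1 -unitfE -unitmxE.
have := deriv_char_poly (complexmx Q - e *m p^T) 1.
rewrite cE -BE derivM derivX mul1r hornerD hornerM hornerX mul1r.
rewrite (horner_deriv_prod_XsubC q1_neq0) -/q.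
rewrite /invmx uB mxtraceZ -q1 => <-.
by field.
Qed.

Lemma kemeny_ginv (R : realType) n (Q : 'M[R]_n) (A G : 'M[R[i]]_n)
    (e p : 'cV[R[i]]_n) :
  1%:M - complexmx Q = A -> A *m e = 0 -> p^T *m A = 0 -> p^T *m e = 1%:M ->
  A + e *m p^T \in unitmx -> A *m G *m A = A ->
  kemeny Q = \tr G - (p^T *m G *m e) 0 0.
Proof.
move=> <- Ae pA pe uB AGA; rewrite -(mxtrace_fundamental Ae pA pe uB AGA).
apply: kemeny_fundamental => //.
by apply/eqP; rewrite eq_sym -subr_eq0 -[X in X - _]mulmx1 -mulmxBr pA.
Qed.

(** * Generalized inverses and null vectors of Schur complements *)

(* S is to be a Schur complement of A, reached by the row operations L and the
   column operations R; E restricts to the block of S and E' extends from it. *)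
Section BlockElimination.
Variables (F : fieldType) (n m : nat) (A : 'M[F]_n) (S : 'M[F]_m).
Variables (L E : 'M[F]_(m, n)) (R E' : 'M[F]_(n, m)).
Hypotheses (LA : L *m A = S *m E) (AR : A *m R = E' *m S) (ER : E *m R = 1%:M).

(** Put [A G A = A] between [L] and [R]: the left side becomes [S E G E' S], the right side
    [S E R = S]. *)
Lemma ginv_schur (G : 'M[F]_n) :
  A *m G *m A = A -> S *m (E *m G *m E') *m S = S.
Proof.
move=> AGA; transitivity (L *m (A *m G *m A) *m R).
  by rewrite !mulmxA -LA -!mulmxA -AR.
by rewrite AGA LA -mulmxA ER mulmx1.
Qed.

Variables (e p : 'cV[F]_n) (q : 'cV[F]_m) (c : F).
Hypotheses (Ae : A *m e = 0) (pA : p^T *m A = 0) (pe : p^T *m e = 1%:M).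
Hypothesis B_unit : A + e *m p^T \in unitmx.
Hypotheses (pE' : p^T *m E' = c *: q^T) (c_neq0 : c != 0).
Hypothesis (qEe : q^T *m (E *m e) = 1%:M).

Lemma schur_ker : S *m (E *m e) = 0.
Proof. by rewrite mulmxA -LA -mulmxA Ae mulmx0. Qed.

(** [c q^T S = p^T E' S = p^T A R = 0]. In the uses below, [c] is the mass of [p] on the block and
    [q] is that block of [p] rescaled to mass 1. *)
Lemma schur_coker : q^T *m S = 0.
Proof.
have: c *: (q^T *m S) = 0.
  by rewrite scalemxAl -pE' -mulmxA -AR mulmxA pA mul0mx.
by move/eqP; rewrite scaler_eq0 (negPf c_neq0) => /eqP.
Qed.

(** A kernel vector [y] has [q^T y = 0] and [S y = 0]. Its lift [R y] lies in the kernel of [A], so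
    it is a multiple of [e]; then [y = E R y] is a multiple of [E e], with factor [q^T y = 0]. *)
Lemma schur_rank1_unit : S + E *m e *m q^T \in unitmx.
Proof.
rewrite -unitmx_tr -row_free_unit; apply: inj_row_free => x /(congr1 trmx).
rewrite trmx_mul trmxK trmx0 => Bx; apply: (can_inj (@trmxK _ _ _)).
rewrite trmx0; move: {x}x^T Bx => y Bx.
have qy : q^T *m y = 0.
  have := congr1 (mulmx q^T) Bx.
  by rewrite mulmx0 mulmxA mulmxDr schur_coker add0r mulmxA qEe mul1mx.
move: Bx; rewrite mulmxDl -(mulmxA _ q^T) qy mulmx0 addr0 => Sy.
have: A *m (R *m y) = 0 by rewrite mulmxA AR -mulmxA Sy mulmx0.
move/(ker_rank1_perturbation Ae pe B_unit)/(congr1 (mulmx E)).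
rewrite mulmxA ER mul1mx mulmxA => yE.
by move: qy; rewrite yE mulmxA qEe mul1mx => ->; rewrite mulmx0.
Qed.

End BlockElimination.

(** * Irreducible stochastic matrices and the maximum principle *)

Section IrreducibleStochastic.
Variable R : realType.

(** Listing the complement of a proper closed set first and the set last puts a zero block at the
    lower left, against irreducibility. *)
Lemma irreducible_closed n (P : 'M[R]_n) (S : {set 'I_n}) :
  irreducible P -> S != set0 ->
  (forall i j, i \in S -> j \notin S -> P i j = 0) -> S = setT.
Proof.
move=> irrP Sn0 clS; apply/eqP; apply: contraT => SnT; case: irrP.
have [x0 x0S] := set0Pn _ Sn0.
pose r := enum (~: S) ++ enum S.
have sr : size r = n by rewrite size_cat -!cardE addnC cardsC card_ord.
have ur : uniq r.
  rewrite cat_uniq !enum_uniq andbT /=; apply/hasPn=> x.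
  by rewrite !mem_enum inE negbK.
have inj_s : injective (fun i : 'I_n => nth x0 r i).
  by move=> i j /eqP; rewrite nth_uniq ?sr // => /eqP/val_inj.
exists (perm inj_s), #|~: S|; split.
  have SC0 : ~: S != set0.
    by apply: contra SnT => /eqP SC; rewrite -[S]setCK SC setC0.
  rewrite card_gt0 SC0 -[X in (_ < X)%N]card_ord -[X in (_ < X)%N](cardsC S).
  by rewrite -[X in (X < _)%N]add0n ltn_add2r card_gt0.
move=> i j ik jk; rewrite !permE; apply: clS.
- rewrite nth_cat -cardE ltnNge ik /= -mem_enum mem_nth //.
  by rewrite -cardE -(ltn_add2r #|~: S|) subnK // cardsC card_ord.
- rewrite nth_cat -cardE jk -in_setC -mem_enum mem_nth //.
  by rewrite -cardE.
Qed.

Variables (n : nat) (P : 'M[R]_n).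
Hypotheses (stP : stochastic P) (irrP : irreducible P).

(* Maximum principle: the set where y is maximal is closed under P. *)
Lemma subharmonic_const (y : 'cV[R]_n) :
  (forall i, y i 0 <= (P *m y) i 0) -> forall i j, y i 0 = y j 0.
Proof.
move=> suby i0; case: stP => P_ge0 P1.
have [i _ maxy] :=
  @Order.TotalTheory.arg_maxP _ _ _ i0 xpredT (fun i => y i 0) isT.
suff ST : [set j | y j 0 == y i 0] = setT.
  move=> j; have := in_setT i0; have := in_setT j.
  by rewrite -ST !inE => /eqP-> /eqP->.
apply: irreducible_closed irrP _ _.
  by apply/set0Pn; exists i; rewrite inE.
move=> a b; rewrite !inE => /eqP ya yb.
have Pd j : 0 <= P a j * (y i 0 - y j 0).
  by rewrite mulr_ge0 // subr_ge0; apply: maxy.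
have sum0 : \sum_j P a j * (y i 0 - y j 0) = 0.
  apply/le_anti; rewrite sumr_ge0 // andbT.
  under eq_bigr do rewrite mulrBr.
  rewrite sumrB -mulr_suml.
  have -> : \sum_j P a j = 1.
    have := congr1 (fun M : 'cV_n => M a 0) P1; rewrite !mxE => <-.
    by apply: eq_bigr => j _; rewrite mxE mulr1.
  by rewrite mul1r subr_le0 -ya; have := suby a; rewrite mxE.
have /eqP := sum0; rewrite psumr_eq0 // => /allP/(_ b (mem_index_enum _)).
by rewrite /= mulf_eq0 subr_eq0 [y i 0 == _]eq_sym (negPf yb) orbF => /eqP.
Qed.

(** [|z|] is subharmonic, by the triangle inequality wherever [z] is harmonic; hence it is constant,
    with value 0 at [i0]. *)
Lemma killed_harmonic_eq0 (z : 'cV[R]_n) i0 :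
  z i0 0 = 0 -> (forall i, z i 0 = 0 \/ (P *m z) i 0 = z i 0) -> z = 0.
Proof.
move=> z0 hz; case: (stP) => P_ge0 _.
have cst := @subharmonic_const (map_mx Num.norm z).
apply/colP=> i; rewrite mxE; apply/eqP; rewrite -normr_eq0.
have := cst _ i i0; rewrite !mxE z0 normr0 => -> // {}i.
rewrite !mxE; case: (hz i) => [->|<-].
  by rewrite normr0 sumr_ge0 // => j _; rewrite mxE mulr_ge0.
rewrite mxE (le_trans (ler_norm_sum _ _ _)) // ler_sum // => j _.
by rewrite mxE normrM ger0_norm.
Qed.

Variable pi : 'cV[R]_n.
Hypothesis pi_st : stationary P pi.

Lemma stationary_coker : pi^T *m (1%:M - P) = 0.
Proof. by rewrite mulmxBr mulmx1 pi_st.1 subrr. Qed.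

Lemma stochastic_ker : (1%:M - P) *m (const_mx 1 : 'cV[R]_n) = 0.
Proof. by rewrite mulmxBl mul1mx stP.2 subrr. Qed.

(** A kernel vector is orthogonal to [pi] and harmonic, hence constant; [pi^T 1 = 1] makes the
    constant 0. *)
Lemma irreducible_rank1_unit :
  1%:M - P + (const_mx 1 : 'cV[R]_n) *m pi^T \in unitmx.
Proof.
rewrite -unitmx_tr -row_free_unit; apply: inj_row_free => x /(congr1 trmx).
rewrite trmx_mul trmxK trmx0 => Bx; apply: (can_inj (@trmxK _ _ _)).
rewrite trmx0; move: {x}x^T Bx => y Bx.
have qy : pi^T *m y = 0.
  have := congr1 (mulmx pi^T) Bx.
  by rewrite mulmx0 mulmxA mulmxDr stationary_coker add0r mulmxA pi_st.2 mul1mx.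
move: Bx; rewrite mulmxDl -mulmxA qy mulmx0 addr0 mulmxBl mul1mx => /eqP.
rewrite subr_eq0 => /eqP Py.
have cst : forall i j, y i 0 = y j 0.
  by apply: subharmonic_const => i; rewrite -Py.
apply/colP=> i; rewrite [RHS]mxE.
have yE : y = const_mx 1 *m (y i 0)%:M.
  by apply/colP=> j; rewrite mul_mx_scalar !mxE mulr1; apply: cst.
move: qy; rewrite {1}yE mulmxA pi_st.2 mul1mx.
move=> /(congr1 (fun M : 'M_1 => M 0 0)).
by rewrite !mxE.
Qed.

(** [stationary] imposes no sign. However, [|pi|^T <= |pi|^T P] entrywise with equal totals, so
    equality holds; left null vectors of [I - P] are multiples of [pi], whence [|pi| = s pi] with
    [s >= 0]. *)
Lemma stationary_ge0 i : 0 <= pi i 0.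
Proof.
case: (stP) => P_ge0 P1; pose a : 'cV[R]_n := map_mx Num.norm pi.
have aP j : a j 0 <= (a^T *m P) 0 j.
  have := congr1 (fun M : 'rV_n => M 0 j) pi_st.1; rewrite !mxE => <-.
  rewrite (le_trans (ler_norm_sum _ _ _)) // ler_sum // => k _.
  by rewrite !mxE normrM [X in _ * X]ger0_norm.
have aA : a^T *m (1%:M - P) = 0.
  rewrite mulmxBr mulmx1; apply/eqP; rewrite subr_eq0 eq_sym -subr_eq0.
  (* [P 1 = 1] preserves the total, so these nonnegative differences sum to 0. *)
  have /eqP : \sum_j ((a^T *m P) 0 j - a j 0) = 0.
    have := congr1 (fun M : 'M_1 => M 0 0) (congr1 (mulmx a^T) P1).
    rewrite mulmxA !mxE => h; rewrite sumrB; apply/eqP; rewrite subr_eq0.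
    move: h; under eq_bigr do rewrite [X in _ * X]mxE mulr1.
    under [X in _ = X -> _]eq_bigr do rewrite [X in _ * X]mxE mulr1 mxE.
    by move->.
  rewrite psumr_eq0 => [/allP h|j _]; last by rewrite subr_ge0.
  apply/eqP/rowP=> j; have := h j (mem_index_enum _) => /eqP.
  by rewrite !mxE.
have := coker_rank1_perturbation stationary_coker pi_st.2
  irreducible_rank1_unit aA.
set s := a^T *m const_mx 1 => /(congr1 (fun M : 'rV_n => M 0 i)).
rewrite [s]mx11_scalar mul_scalar_mx !mxE => aE.
rewrite leNgt; apply/negP => pi_lt0.
have : `|pi i 0| <= 0.
  rewrite aE mulr_ge0_le0 ?(ltW pi_lt0) // sumr_ge0 // => j _.
  by rewrite !mxE mulr1.
by rewrite normr_le0 => /eqP pi0; rewrite pi0 ltxx in pi_lt0.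
Qed.

End IrreducibleStochastic.

(** * Block Gaussian elimination *)

Section SchurComplements.
Variables (F : fieldType) (m k : nat) (A : 'M[F]_(m + k)).

(** The row operation clears the upper right block, the column operation the lower left one; they
    serve as [L] and [R] in the block elimination. *)
Lemma schur_elim1 :
  let S := ulsubmx A - ursubmx A *m invmx (drsubmx A) *m dlsubmx A in
  drsubmx A \in unitmx ->
  row_mx 1%:M (- (ursubmx A *m invmx (drsubmx A))) *m A = S *m row_mx 1%:M 0 /\
  A *m col_mx 1%:M (- (invmx (drsubmx A) *m dlsubmx A)) = col_mx 1%:M 0 *m S.
Proof.
move=> S uA; rewrite -[X in _ *m X = _ /\ _](submxK A).
rewrite -[X in _ /\ X *m _ = _](submxK A).
rewrite mul_row_block mul_block_col mul_mx_row mul_col_mx !mul1mx !mulmx1.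
rewrite mulmx0 mul0mx !(mulNmx, mulmxN) (mulmxKV uA) (mulKVmx uA) !subrr.
by rewrite mulmxA.
Qed.

Lemma schur_elim2 :
  let S := drsubmx A - dlsubmx A *m invmx (ulsubmx A) *m ursubmx A in
  ulsubmx A \in unitmx ->
  row_mx (- (dlsubmx A *m invmx (ulsubmx A))) 1%:M *m A = S *m row_mx 0 1%:M /\
  A *m col_mx (- (invmx (ulsubmx A) *m ursubmx A)) 1%:M = col_mx 0 1%:M *m S.
Proof.
move=> S uA; rewrite -[X in _ *m X = _ /\ _](submxK A).
rewrite -[X in _ /\ X *m _ = _](submxK A).
rewrite mul_row_block mul_block_col mul_mx_row mul_col_mx !mul1mx !mulmx1.
rewrite mulmx0 mul0mx !(mulNmx, mulmxN) (mulmxKV uA) (mulKVmx uA) !addNr.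
by rewrite mulmxA ![- _ + _]addrC.
Qed.

End SchurComplements.

(** * The partitioned chain *)

Section Partition.
Variables (R : realType) (m k : nat) (P : 'M[R]_(m + k)).
Hypotheses (stP : stochastic P) (irrP : irreducible P).

Lemma ulsub_I_subE : ulsubmx (1%:M - P) = 1%:M - ulsubmx P.
Proof. by apply/matrixP=> i j; rewrite !mxE eq_lshift. Qed.

Lemma drsub_I_subE : drsubmx (1%:M - P) = 1%:M - drsubmx P.
Proof. by apply/matrixP=> i j; rewrite !mxE eq_rshift. Qed.

Lemma ursub_I_subE : ursubmx (1%:M - P) = - ursubmx P.
Proof. by apply/matrixP=> i j; rewrite !mxE eq_lrshift sub0r. Qed.

Lemma dlsub_I_subE : dlsubmx (1%:M - P) = - dlsubmx P.
Proof. by apply/matrixP=> i j; rewrite !mxE eq_rlshift sub0r. Qed.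

(** A vector fixed by [P_11], extended by zero, is harmonic on the first block and zero on the
    second, which [0 < k] makes nonempty; so it vanishes. *)
Lemma ulsub_I_sub_unit : (0 < k)%N -> ulsubmx (1%:M - P) \in unitmx.
Proof.
move=> k_gt0; rewrite ulsub_I_subE -unitmx_tr -row_free_unit.
apply: inj_row_free => x /(congr1 trmx); rewrite trmx_mul trmxK trmx0.
move=> Px; apply: (can_inj (@trmxK _ _ _)); rewrite trmx0.
move: {x}x^T Px => y /eqP; rewrite mulmxBl mul1mx subr_eq0 => /eqP Py.
suff: col_mx y (0 : 'cV_k) = 0 by rewrite -col_mx0 => /eq_col_mx[].
apply: (killed_harmonic_eq0 stP irrP (i0 := rshift m (Ordinal k_gt0))).
  by rewrite col_mxEd mxE.
rewrite -[X in X *m _](submxK P) mul_block_col !mulmx0 !addr0 -Py => i.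
by case: (split_ordP i) => j ->; rewrite ?col_mxEu ?col_mxEd ?mxE; [right|left].
Qed.

Lemma drsub_I_sub_unit : (0 < m)%N -> drsubmx (1%:M - P) \in unitmx.
Proof.
move=> m_gt0; rewrite drsub_I_subE -unitmx_tr -row_free_unit.
apply: inj_row_free => x /(congr1 trmx); rewrite trmx_mul trmxK trmx0.
move=> Px; apply: (can_inj (@trmxK _ _ _)); rewrite trmx0.
move: {x}x^T Px => y /eqP; rewrite mulmxBl mul1mx subr_eq0 => /eqP Py.
suff: col_mx (0 : 'cV_m) y = 0 by rewrite -col_mx0 => /eq_col_mx[].
apply: (killed_harmonic_eq0 stP irrP (i0 := lshift k (Ordinal m_gt0))).
  by rewrite col_mxEu mxE.
rewrite -[X in X *m _](submxK P) mul_block_col !mulmx0 !add0r -Py => i.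
by case: (split_ordP i) => j ->; rewrite ?col_mxEu ?col_mxEd ?mxE; [left|right].
Qed.

Variable pi : 'cV[R]_(m + k).
Hypothesis pi_st : stationary P pi.

Lemma norm1_sum n (x : 'cV[R]_n) :
  (forall i, 0 <= x i 0) -> x^T *m const_mx 1 = (Defs.norm1 x)%:M.
Proof.
move=> x_ge0; apply/matrixP=> i j; rewrite !ord1 !mxE mulr1n.
by apply: eq_bigr => l _; rewrite !mxE mulr1 ger0_norm.
Qed.

Lemma norm1_eq0 n (x : 'cV[R]_n) : Defs.norm1 x = 0 -> x = 0.
Proof.
move/eqP; rewrite psumr_eq0 // => /allP h; apply/colP=> i; rewrite mxE.
by have := h i (mem_index_enum _); rewrite normr_eq0 => /eqP.
Qed.

Lemma usub_stationary_ge0 i : 0 <= usubmx pi i 0.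
Proof. by rewrite mxE; apply: (stationary_ge0 stP irrP pi_st). Qed.

Lemma dsub_stationary_ge0 i : 0 <= dsubmx pi i 0.
Proof. by rewrite mxE; apply: (stationary_ge0 stP irrP pi_st). Qed.

Lemma norm1_stationary : Defs.norm1 (usubmx pi) + Defs.norm1 (dsubmx pi) = 1.
Proof.
have := pi_st.2; rewrite -[in X in X -> _](vsubmxK pi) tr_col_mx -col_mx_const.
rewrite mul_row_col !norm1_sum; last 2 first.
- exact: dsub_stationary_ge0.
- exact: usub_stationary_ge0.
by move/(congr1 (fun M : 'M_1 => M 0 0)); rewrite !mxE !mulr1n.
Qed.

Lemma stationary_neq0 : pi != 0.
Proof.
apply/eqP=> pi0; have := pi_st.2; rewrite pi0 trmx0 mul0mx => /eqP.
by rewrite eq_sym oner_eq0.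
Qed.

(** If [pi_1 = 0], stationarity on the second block reads [pi_2^T (I - P_22) = 0], and
    nonsingularity gives [pi = 0]. *)
Lemma norm1_usub_neq0 : (0 < m)%N -> Defs.norm1 (usubmx pi) != 0.
Proof.
move=> m_gt0; apply: contraNneq stationary_neq0 => /norm1_eq0 u0.
have := stationary_coker pi_st.
rewrite -[1%:M - P]submxK -[X in X^T]vsubmxK tr_col_mx u0 trmx0.
rewrite mul_row_block !mul0mx !add0r -row_mx0 => /eq_row_mx[_ d0].
rewrite -[pi]vsubmxK u0 -[dsubmx pi]trmxK.
by rewrite -(mulmxK (drsub_I_sub_unit m_gt0) (dsubmx pi)^T) d0 mul0mx trmx0
  col_mx0.
Qed.

Lemma norm1_dsub_neq0 : (0 < k)%N -> Defs.norm1 (dsubmx pi) != 0.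
Proof.
move=> k_gt0; apply: contraNneq stationary_neq0 => /norm1_eq0 u0.
have := stationary_coker pi_st.
rewrite -[1%:M - P]submxK -[X in X^T]vsubmxK tr_col_mx u0 trmx0.
rewrite mul_row_block !mul0mx !addr0 -row_mx0 => /eq_row_mx[d0 _].
rewrite -[pi]vsubmxK u0 -[usubmx pi]trmxK.
by rewrite -(mulmxK (ulsub_I_sub_unit k_gt0) (usubmx pi)^T) d0 mul0mx trmx0
  col_mx0.
Qed.

(** * The chain over the complex numbers *)

Lemma complexmx_const1 a b : complexmx (const_mx 1 : 'M[R]_(a, b)) = const_mx 1.
Proof. by rewrite /complexmx map_const_mx rmorph1. Qed.

Lemma complexmx_I_sub a (M : 'M[R]_a) :
  1%:M - complexmx M = complexmx (1%:M - M).
Proof. by rewrite /complexmx map_mxB map_mx1. Qed.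

Lemma normalize1_sum n (x : 'cV[R]_n) :
  (forall i, 0 <= x i 0) -> Defs.norm1 x != 0 ->
  (complexmx (normalize1 x))^T *m const_mx 1 = 1%:M.
Proof.
move=> x_ge0 x_neq0; rewrite -complexmx_const1 /complexmx map_trmx -map_mxM.
rewrite /normalize1 linearZ /= -scalemxAl norm1_sum // scale_scalar_mx.
by rewrite mulVf // map_mx1.
Qed.

Lemma complexmx_normalize1 n (x : 'cV[R]_n) :
  Defs.norm1 x != 0 ->
  complexmx x = (Defs.norm1 x)%:C%C *: complexmx (normalize1 x).
Proof.
by move=> x_neq0; rewrite -map_mxZ /normalize1 scalerA mulfV // scale1r.
Qed.

Let e : 'cV[R[i]]_(m + k) := const_mx 1.
Let A : 'M[R[i]]_(m + k) := 1%:M - complexmx P.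
Let p : 'cV[R[i]]_(m + k) := complexmx pi.

Lemma complex_ker : A *m e = 0.
Proof.
rewrite /A /e -complexmx_const1 complexmx_I_sub -map_mxM stochastic_ker //.
exact: map_mx0.
Qed.

Lemma complex_coker : p^T *m A = 0.
Proof.
by rewrite /A complexmx_I_sub map_trmx -map_mxM stationary_coker // map_mx0.
Qed.

Lemma complex_stationary_sum : p^T *m e = 1%:M.
Proof.
by rewrite /e -complexmx_const1 map_trmx -map_mxM pi_st.2 map_mx1.
Qed.

Lemma complex_rank1_unit : A + e *m p^T \in unitmx.
Proof.
rewrite /A /e -complexmx_const1 complexmx_I_sub map_trmx -map_mxM -map_mxD.
by rewrite map_unitmx irreducible_rank1_unit.
Qed.

(** * Kemeny's constants of the stochastic complements *)

Variable G : 'M[R[i]]_(m + k).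
Hypothesis AGA : A *m G *m A = A.
Hypotheses (m_gt0 : (0 < m)%N) (k_gt0 : (0 < k)%N).

Lemma kemeny_schur a (Q : 'M[R]_a) (L E : 'M[R[i]]_(a, m + k))
    (T E' : 'M[R[i]]_(m + k, a)) (h : 'cV[R[i]]_a) c :
  let S := 1%:M - complexmx Q in
  L *m A = S *m E -> A *m T = E' *m S -> E *m T = 1%:M ->
  p^T *m E' = c *: h^T -> c != 0 -> h^T *m (E *m e) = 1%:M ->
  kemeny Q = \tr (E *m G *m E') - (h^T *m (E *m G *m E') *m (E *m e)) 0 0.
Proof.
move=> S LA AT ET pE' c_neq0 hEe; apply: (kemeny_ginv (erefl S)).
- exact: (schur_ker LA complex_ker).
- exact: (schur_coker AT complex_coker pE' c_neq0).
- exact: hEe.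
- exact: (schur_rank1_unit AT ET complex_ker complex_coker
           complex_stationary_sum complex_rank1_unit pE' c_neq0 hEe).
- exact: (ginv_schur LA AT ET AGA).
Qed.

Lemma kemeny_stoch_compl1 :
  let h := complexmx (normalize1 (usubmx pi)) in
  kemeny (stoch_compl1 P) =
    \tr (ulsubmx G) - (h^T *m ulsubmx G *m (const_mx 1 : 'cV_m)) 0 0.
Proof.
move=> h; have uA : drsubmx A \in unitmx.
  by rewrite /A complexmx_I_sub -map_drsubmx map_unitmx drsub_I_sub_unit.
pose S := ulsubmx A - ursubmx A *m invmx (drsubmx A) *m dlsubmx A.
have [LA AR] := schur_elim1 uA; rewrite -/S in LA AR.
pose E : 'M[R[i]]_(m, m + k) := row_mx 1%:M 0.
pose E' : 'M[R[i]]_(m + k, m) := col_mx 1%:M 0.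
have ER : E *m col_mx 1%:M (- (invmx (drsubmx A) *m dlsubmx A)) = 1%:M.
  by rewrite mul_row_col mul1mx mul0mx addr0.
have EGE : E *m G *m E' = ulsubmx G.
  rewrite -[X in _ *m X *m _](submxK G) mul_row_block mul_row_col.
  by rewrite !mul1mx !mul0mx mulmx1 mulmx0 !addr0.
have Ee : E *m e = const_mx 1.
  by rewrite /e -col_mx_const mul_row_col mul1mx mul0mx addr0.
have c_neq0 := norm1_usub_neq0 m_gt0.
(* [p^T E'] is [pi_1^T], so the scalar [c] is [||pi_1||]. *)
have pE' : p^T *m E' = (Defs.norm1 (usubmx pi))%:C%C *: h^T.
  rewrite -linearZ -complexmx_normalize1 // -[X in X^T *m _]vsubmxK tr_col_mx.
  by rewrite mul_row_col mulmx1 mulmx0 addr0 /p -map_usubmx.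
have cC : (Defs.norm1 (usubmx pi))%:C%C != 0 by rewrite fmorph_eq0.
have h1 : h^T *m (E *m e) = 1%:M.
  by rewrite Ee normalize1_sum //; apply: usub_stationary_ge0.
(* The minus signs of the two off-diagonal blocks of [I - P] cancel, so its Schur complement is
   [I - P_1]. *)
have SE : 1%:M - complexmx (stoch_compl1 P) = S.
  rewrite complexmx_I_sub /S /A complexmx_I_sub.
  rewrite -map_ulsubmx -map_ursubmx -map_dlsubmx -map_drsubmx -map_invmx.
  rewrite -!map_mxM -map_mxB; congr (map_mx _ _).
  rewrite ulsub_I_subE ursub_I_subE dlsub_I_subE drsub_I_subE /stoch_compl1.
  by rewrite !mulNmx mulmxN opprK opprD addrA.
rewrite -EGE -Ee; rewrite -SE in LA AR.
exact: (kemeny_schur LA AR ER pE' cC h1).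
Qed.

Lemma kemeny_stoch_compl2 :
  let h := complexmx (normalize1 (dsubmx pi)) in
  kemeny (stoch_compl2 P) =
    \tr (drsubmx G) - (h^T *m drsubmx G *m (const_mx 1 : 'cV_k)) 0 0.
Proof.
move=> h; have uA : ulsubmx A \in unitmx.
  by rewrite /A complexmx_I_sub -map_ulsubmx map_unitmx ulsub_I_sub_unit.
pose S := drsubmx A - dlsubmx A *m invmx (ulsubmx A) *m ursubmx A.
have [LA AR] := schur_elim2 uA; rewrite -/S in LA AR.
pose E : 'M[R[i]]_(k, m + k) := row_mx 0 1%:M.
pose E' : 'M[R[i]]_(m + k, k) := col_mx 0 1%:M.
have ER : E *m col_mx (- (invmx (ulsubmx A) *m ursubmx A)) 1%:M = 1%:M.
  by rewrite mul_row_col mul1mx mul0mx add0r.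
have EGE : E *m G *m E' = drsubmx G.
  rewrite -[X in _ *m X *m _](submxK G) mul_row_block mul_row_col.
  by rewrite !mul1mx !mul0mx mulmx1 mulmx0 !add0r.
have Ee : E *m e = const_mx 1.
  by rewrite /e -col_mx_const mul_row_col mul1mx mul0mx add0r.
have c_neq0 := norm1_dsub_neq0 k_gt0.
have pE' : p^T *m E' = (Defs.norm1 (dsubmx pi))%:C%C *: h^T.
  rewrite -linearZ -complexmx_normalize1 // -[X in X^T *m _]vsubmxK tr_col_mx.
  by rewrite mul_row_col mulmx1 mulmx0 add0r /p -map_dsubmx.
have cC : (Defs.norm1 (dsubmx pi))%:C%C != 0 by rewrite fmorph_eq0.
have h1 : h^T *m (E *m e) = 1%:M.
  by rewrite Ee normalize1_sum //; apply: dsub_stationary_ge0.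
have SE : 1%:M - complexmx (stoch_compl2 P) = S.
  rewrite complexmx_I_sub /S /A complexmx_I_sub.
  rewrite -map_ulsubmx -map_ursubmx -map_dlsubmx -map_drsubmx -map_invmx.
  rewrite -!map_mxM -map_mxB; congr (map_mx _ _).
  rewrite ulsub_I_subE ursub_I_subE dlsub_I_subE drsub_I_subE /stoch_compl2.
  by rewrite !mulNmx mulmxN opprK opprD addrA.
rewrite -EGE -Ee; rewrite -SE in LA AR.
exact: (kemeny_schur LA AR ER pE' cC h1).
Qed.

End Partition.

(** * Decomposition of Kemeny's constant *)

Theorem theorem3p3 (R : realType) (m k : nat) (hm : (0 < m)%N) (hk : (0 < k)%N)
    (P : 'M[R]_(m + k)) (pi : 'cV[R]_(m + k)) (u v : 'cV[R[i]]_(m + k))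
    (hstoch : stochastic P) (hirr : irreducible P) (hpi : stationary P pi)
    (hv : (v^T *m (const_mx 1 : 'cV[R[i]]_(m + k))) 0 0 != 0)
    (hu : ((complexmx pi)^T *m u) 0 0 != 0) :
  (1%:M - complexmx P + u *m v^T) \in unitmx /\
  kemeny P = kemeny (stoch_compl1 P) + kemeny (stoch_compl2 P)
             + kemeny_gamma P pi u v.
Proof.
have Ae := complex_ker hstoch.
have pA := complex_coker hpi.
have pe := complex_stationary_sum hpi.
have uB := complex_rank1_unit hstoch hirr hpi.
(* [invmx] returns a singular matrix unchanged, so this conjunct makes the inverse in gamma a true
   one. *)
split; first exact: (unitmx_rank1_perturbation Ae pA pe uB hv hu).
have AGA := ginv_rank1_perturbation Ae pA pe uB hv hu.
(* The same [G = (I - P + u v^T)^-1] serves for [P] and for both complements. *)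
rewrite (kemeny_stoch_compl1 hstoch hirr hpi AGA hm).
rewrite (kemeny_stoch_compl2 hstoch hirr hpi AGA hk).
rewrite (kemeny_ginv (erefl _) Ae pA pe uB AGA) /kemeny_gamma.
set G := invmx _.
have a_neq0 := norm1_usub_neq0 hstoch hirr hpi hm.
have b_neq0 := norm1_dsub_neq0 hstoch hirr hpi hk.
pose a := (Defs.norm1 (usubmx pi))%:C%C.
pose b := (Defs.norm1 (dsubmx pi))%:C%C.
have ab1 : a + b = 1.
  by rewrite -rmorphD /= (norm1_stationary hstoch hirr hpi).
have -> : complexmx pi = col_mx (a *: complexmx (normalize1 (usubmx pi)))
                                (b *: complexmx (normalize1 (dsubmx pi))).
  by rewrite -!complexmx_normalize1 // /complexmx -map_col_mx vsubmxK.
rewrite [complexmx (row_mx _ _)]map_row_mx [complexmx (col_mx _ _)]map_col_mx.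
rewrite !map_mxN !map_mxZ -!map_trmx -!/(complexmx _) !complexmx_const1.
set h1 := complexmx _; set h2 := complexmx _.
rewrite -[in \tr G](submxK G) mxtrace_block.
rewrite -[in X in _ - X 0 0 = _](submxK G).
rewrite -[X in _ = _ + (_ *m X *m _) 0 0](submxK G).
rewrite -col_mx_const tr_col_mx !mul_row_block !mul_row_col !linearZ /=.
rewrite !(mulmxDl, mulmxN, mulNmx) -!(scalemxAl, scalemxAr) !mxE.
rewrite -/a -/b; set g11 := \sum_j _; set g21 := \sum_j _.
set g12 := \sum_j _; set g22 := \sum_j _.
(* With [gij] the product of the normalized [pi_i^T], the block [G_ij] and the ones vector, the
   traces cancel and leave [g11 + g22 - a (g11 + g12) - b (g21 + g22)]; [a + b = 1] turns this into
   [b g11 - a g12 - b g21 + a g22], which is gamma. *)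
have -> : a = 1 - b by rewrite -ab1 addrK.
by ring.
Qed.
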